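(* Let $f\in\mathbb{R}[x_1,\ldots,x_n]$ be positive on a compact convex set $X\subset\mathbb{R}^n$ containing at least two points. Set $R=\max\{|x|:x\in X\}$ and let $m$ satisfy $$0<m\le\min\{f(x):x\in X\}.$$ Then for any $D\ge\mathbb{D}(f,R)$ and any integer $N\ge\mathcal{N}(m,R,D)$ the polynomial $\varphi_N(x)=(1+x_1^2+\cdots+x_n^2)^Nf(x)$ is strongly convex on $X$.
   Context: For $f=\sum_{j=0}^d\sum_{|\nu|=j}a_\nu x^\nu$ (multi-index notation, $|\nu|=\nu_1+\cdots+\nu_n$) and $R\ge0$, $$\mathbb{D}(f,R)=\max\Big\{1,\ \sqrt{1+R^2}\sum_{j=1}^d\sum_{|\nu|=j}j|a_\nu|R^{j-1},\ (1+R^2)\sum_{j=2}^d\sum_{|\nu|=j}j(j-1)|a_\nu|R^{j-2}\Big\}.$$ For positive numbers $m,R,D$, $$\mathcal{N}(m,R,D)=\max\left\{\frac{D}{m}+\frac{m}{16D},\ \frac{(1+R^2)D}{Rm}+1,\ \frac{4D^2}{m^2}+2,\ \frac{(1+R^2)D}{2m}\right\}.$$ A function $\varphi$ is strongly convex on a convex set $X$ if there is $\mu>0$ such that $\varphi(x)-\frac{\mu}{2}|x|^2$ is convex on $X$. *)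

(* Defs.v *)
From HB Require Import structures.
From mathcomp Require Import all_boot all_order all_algebra.
(* The notations of [mpoly] are left out: they clash with those of the
   analysis library. *)
From mathcomp Require Import (canonicals, coercions) mpoly.
From mathcomp Require Import all_classical all_reals all_analysis.

Set Implicit Arguments.
Unset Strict Implicit.
Unset Printing Implicit Defensive.

Import Order.TTheory GRing.Theory Num.Theory.
Import numFieldNormedType.Exports.

Local Open Scope classical_set_scope.
Local Open Scope ring_scope.

(* The library's norm on ['rV[R]_n] is the sup norm, hence this definition.
   Both norms induce the topology that [compact] refers to. *)
Definition enorm (R : realType) (n : nat) (x : 'rV[R]_n) : R :=
  Num.sqrt (\sum_(i < n) x 0 i ^+ 2).

Definition is_maximum (R : realType) (A : set R) (r : R) : Prop :=
  A r /\ ubound A r.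

Definition is_minimum (R : realType) (A : set R) (r : R) : Prop :=
  A r /\ lbound A r.

Definition peval (R : realType) (n : nat) (f : mpoly.mpoly n R)
    (x : 'rV[R]_n) : R :=
  mpoly.meval (fun i => x 0 i) f.

(* [mpoly.msize f] is [d.+1], where [d] is the degree of [f], so [j] ranges over
   [1, ..., d], resp. [2, ..., d]; the multi-indices outside [mpoly.msupp f]
   have coefficient zero. *)
Definition Dconst (R : realType) (n : nat) (f : mpoly.mpoly n R) (r : R) : R :=
  Num.max 1
    (Num.max
      (Num.sqrt (1 + r ^+ 2) *
        \sum_(1 <= j < mpoly.msize f)
          \sum_(nu <- mpoly.msupp f | mpoly.mdeg nu == j)
            j%:R * `|mpoly.mcoeff nu f| * r ^+ (j - 1))
      ((1 + r ^+ 2) *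
        \sum_(2 <= j < mpoly.msize f)
          \sum_(nu <- mpoly.msupp f | mpoly.mdeg nu == j)
            (j * (j - 1))%:R * `|mpoly.mcoeff nu f| * r ^+ (j - 2))).

Definition Nconst (R : realType) (m r D : R) : R :=
  Num.max (D / m + m / (16 * D))
    (Num.max ((1 + r ^+ 2) * D / (r * m) + 1)
      (Num.max (4 * D ^+ 2 / m ^+ 2 + 2)
        ((1 + r ^+ 2) * D / (2 * m)))).

(* [mpoly.mpolyX R (mpoly.mnm1 i)] is the variable x_i. *)
Definition phi_poly (R : realType) (n : nat) (f : mpoly.mpoly n R) (N : nat) :
    mpoly.mpoly n R :=
  (1 + \sum_(i < n) mpoly.mpolyX R (mpoly.mnm1 i) ^+ 2) ^+ N * f.

Definition strongly_convex (R : realType) (n : nat) (X : set 'rV[R]_n)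
    (phi : 'rV[R]_n -> R) : Prop :=
  exists2 mu : R, 0 < mu &
    convex_function X (fun x => phi x - mu / 2 * enorm x ^+ 2).

(* Main.v *)
(** Restrict phi_N to a line z = x + t v.  With q = 1 + |z|^2 and g = f(z),
    phi_N'' = q^(N-2) (N(N-1) q'^2 g + N q'' q g + 2 N q q' g' + q^2 g''),
    where q'' = 2 |v|^2, |g'| <= D |v| / sqrt(1 + R^2) and
    |g''| <= D |v|^2 / (1 + R^2).  As a quadratic form in q' and |v|, the bracket
    is at least m |v|^2 q as soon as N >= 2, N >= D / m and
    N >= 4 D^2 / m^2 + 2.  Since q >= 1, the modulus of convexity m works. *)
Require Import Defs.
From mathcomp Require Import all_boot all_order all_algebra.
From mathcomp Require Import (canonicals, coercions) mpoly.
From mathcomp Require Import all_classical all_reals all_analysis.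
From mathcomp Require Import ring lra.

Set Implicit Arguments.
Unset Strict Implicit.
Unset Printing Implicit Defensive.

Import Order.TTheory GRing.Theory Num.Theory.
Import numFieldNormedType.Exports.

Local Open Scope classical_set_scope.
Local Open Scope ring_scope.

(** * Second derivative test on the unit interval *)

(** Convexity on [X] is tested on segments, where the function becomes a univariate polynomial. As
    in [conv], [t] weighs the endpoint 0, hence the point [1 - t]. *)
Lemma poly_convex01 (R : realType) (p : {poly R}) (t : {i01 R}) :
  (forall s : R, 0 <= s <= 1 -> 0 <= (p^`()^`()).[s]) ->
  p.[1 - t%:num] <= t%:num * p.[0] + (1 - t%:num) * p.[1].
Proof.
move=> ddp_ge0.
have Dp : 'D_1 (horner p) = horner p^`().
  by apply/funext => s; rewrite derive_val.
have := @second_derivative_convex R (horner p) 0 1 _ _ _ _ _ t ler01.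
rewrite !convRE mulr0 add0r mulr1; apply.
- move=> s /andP[s_gt0 s_lt1]; rewrite Dp derive_val.
  by apply: ddp_ge0; rewrite !ltW.
- by apply: cvg_at_left_filter; exact: continuous_horner.
- by apply: cvg_at_right_filter; exact: continuous_horner.
- by move=> s _; exact: derivable_horner.
- by move=> s _; rewrite Dp; exact: derivable_horner.
Qed.

(** * Derivatives of products of affine functions *)

(* The value and first two derivatives of [p] at [t] are bounded by those of a
   product of [j] affine functions of values at most [r] and slopes at most [b].
   Truncation in [j - 1] and [j - 2] is harmless: the factors [j] and
   [j * (j - 1)] then vanish. *)
Definition jet_bound (R : realFieldType) (t r b : R) (j : nat) (p : {poly R}) :=
  [/\ `|p.[t]| <= r ^+ j,
      `|(p^`()).[t]| <= j%:R * r ^+ (j - 1) * b &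
      `|(p^`()^`()).[t]| <= (j * (j - 1))%:R * r ^+ (j - 2) * b ^+ 2].

Lemma jet_bound1 (R : realFieldType) (t r b : R) : jet_bound t r b 0 1.
Proof.
by split; rewrite -polyC1 ?derivC ?hornerC ?normr0 ?normr1 ?expr0 ?mul0r.
Qed.

(** Leibniz rule: the coefficients of the second derivative add up because
    [i(i-1) + 2ij + j(j-1) = (i+j)(i+j-1)]. *)
Lemma jet_boundM (R : realFieldType) (t r b : R) (i j : nat) (p q : {poly R}) :
  0 <= r -> 0 <= b -> jet_bound t r b i p -> jet_bound t r b j q ->
  jet_bound t r b (i + j) (p * q).
Proof.
move=> r_ge0 b_ge0 [p0 p1 p2] [q0 q1 q2].
split.
- by rewrite hornerM normrM exprD ler_pM.
- rewrite derivM !hornerE; apply: (le_trans (ler_normD _ _)); rewrite !normrM.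
  apply: (le_trans (lerD (ler_pM _ _ p1 q0) (ler_pM _ _ p0 q1))) => //.
  rewrite le_eqVlt; apply/orP; left; apply/eqP.
  case: i {p0 p1 p2} => [|i]; first by rewrite !add0n; ring.
  case: j {q0 q1 q2} => [|j]; first by rewrite !addn0; ring.
  by rewrite addSn addnS !subSS !subn0 -!natr1 natrD !exprS exprD; ring.
- have -> : (p * q)^`()^`() =
      p^`()^`() * q + (2%:R * (p^`() * q^`()) + p * q^`()^`()).
    by rewrite !poly.derivE; ring.
  rewrite !hornerD !hornerM hornerMn hornerC.
  apply: (le_trans (ler_normD _ _)).
  apply: (le_trans (lerD (lexx _) (ler_normD _ _))).
  rewrite !normrM normr_nat.
  have A := ler_pM (normr_ge0 _) (normr_ge0 _) p2 q0.
  have B := ler_pM (normr_ge0 _) (normr_ge0 _) p1 q1.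
  have C := ler_pM (normr_ge0 _) (normr_ge0 _) p0 q2.
  apply: (le_trans (lerD A (lerD (ler_wpM2l (ler0n _ 2) B) C))).
  rewrite le_eqVlt; apply/orP; left; apply/eqP.
  (* Both sides are equal, but exponents such as [i - 2] are truncated, so the values 0, 1 and at
     least 2 are treated separately. *)
  case: i {p0 p1 p2 A B C} => [|[|i]].
  + by rewrite !add0n; ring.
  + case: j {q0 q1 q2} => [|[|j]]; first by rewrite !addn0; ring.
      by rewrite !subSS !subn0; ring.
    by rewrite !add1n !subSS !subn0 !natrM -!natr1 !exprS; ring.
  + case: j {q0 q1 q2} => [|[|j]]; first by rewrite !addn0; ring.
      by rewrite !addn1 !subSS !subn0 !natrM -!natr1 !exprS; ring.
    by rewrite !addSn !addnS !subSS !subn0 !natrM -!natr1 natrD !exprS exprD; ring.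
Qed.

Lemma jet_boundX (R : realFieldType) (t r b : R) (i k : nat) (p : {poly R}) :
  0 <= r -> 0 <= b -> jet_bound t r b i p -> jet_bound t r b (i * k) (p ^+ k).
Proof.
move=> r_ge0 b_ge0 pP; elim: k => [|k IHk].
  by rewrite muln0 expr0; exact: jet_bound1.
by rewrite mulnS exprS; exact: jet_boundM.
Qed.

Lemma jet_bound_prod (R : realFieldType) (t r b : R) (I : Type) (s : seq I)
    (d : I -> nat) (p : I -> {poly R}) :
  0 <= r -> 0 <= b -> (forall i, jet_bound t r b (d i) (p i)) ->
  jet_bound t r b (\sum_(i <- s) d i)%N (\prod_(i <- s) p i).
Proof.
move=> r_ge0 b_ge0 pP; apply: (big_rec2 (jet_bound t r b)).
  exact: jet_bound1.
by move=> i k q _ kq; exact: jet_boundM.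
Qed.

Lemma jet_bound_line (R : realFieldType) (t r b u v : R) :
  `|u + v * t| <= r -> `|v| <= b -> jet_bound t r b 1 (u%:P + v *: 'X).
Proof.
split; rewrite ?poly.derivE ?hornerE ?normr0 //=; lra.
Qed.

(** Each [i] lies in one slice only, that of [d i], and the slices below [a] would contribute zero.
    This flattens the double sums of [Dconst]. *)
Lemma sum_by_degree (V : nmodType) (I : eqType) (s : seq I) (d : I -> nat)
    (a k : nat) (F : nat -> I -> V) :
  {in s, forall i, d i < k}%N -> (forall i j, (j < a)%N -> F j i = 0) ->
  \sum_(a <= j < k) \sum_(i <- s | d i == j) F j i = \sum_(i <- s) F (d i) i.
Proof.
move=> d_lt F0; rewrite (exchange_big_dep xpredT) //= big_seq [RHS]big_seq.
apply: eq_bigr => i /d_lt di_lt.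
under eq_bigl do rewrite eq_sym.
by rewrite big_nat1_eq di_lt andbT; case: leqP => // /F0.
Qed.

(** * Lower bound for the second derivative *)

(* The bracket of the second derivative, with [w] for q', [b] for |v| and [q]
   still to be divided out; [w ^+ 2 / q >= u ^+ 2] with [u := `|w| / sQ] reduces it
   to a quadratic in [u] that no longer involves [q]. *)
Lemma power_growth_bound (R : realFieldType) (Q m D b q w g g1 g2 sQ N : R) :
  0 < m -> 0 <= D -> 0 <= b -> 1 <= q <= Q -> 0 < sQ -> sQ ^+ 2 = Q ->
  m <= g -> sQ * `|g1| <= b * D -> Q * `|g2| <= b ^+ 2 * D ->
  2 <= N -> D <= N * m -> 4 * D ^+ 2 + m ^+ 2 <= (N - 1) * m ^+ 2 ->
  m * b ^+ 2 * q <= N * (N - 1) * w ^+ 2 * g + 2 * N * b ^+ 2 * q * g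
    + 2 * N * q * w * g1 + q ^+ 2 * g2.
Proof.
move=> m_gt0 D_ge0 b_ge0 /andP[q_ge1 q_le] sQ_gt0 sQ2 g_ge g1_le g2_le N_ge2 DN mDN.
have q_gt0 : 0 < q by lra.
have Q_gt0 : 0 < Q by lra.
pose u : R := `|w| / sQ.
have u_ge0 : 0 <= u by rewrite divr_ge0 // ltW.
have wE : `|w| = u * sQ by rewrite divfK // gt_eqF.
have w2E : w ^+ 2 = u ^+ 2 * Q by rewrite -real_normK ?num_real // wE exprMn sQ2.
have T1 : N * (N - 1) * u ^+ 2 * m * q <= N * (N - 1) * w ^+ 2 * g.
  have c_ge0 : 0 <= N * (N - 1) * u ^+ 2.
    by rewrite mulr_ge0 ?exprn_ge0 // mulr_ge0 //; lra.
  have mq_le : m * q <= g * Q by rewrite ler_pM // ltW.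
  by rewrite w2E; have := ler_wpM2l c_ge0 mq_le; lra.
have T2 : 2 * N * b ^+ 2 * q * m <= 2 * N * b ^+ 2 * q * g.
  by rewrite ler_wpM2l // mulr_ge0 ?(ltW q_gt0) // mulr_ge0 ?exprn_ge0 //; lra.
have T3 : - (2 * N * q * (u * (b * D))) <= 2 * N * q * w * g1.
  have wg1 : `|w * g1| <= u * (b * D) by rewrite normrM wE -mulrA ler_wpM2l.
  have c_ge0 : 0 <= 2 * N * q by rewrite !mulr_ge0 //; lra.
  by have := ler_wpM2l c_ge0 (lerNnormlW wg1); lra.
have T4 : - (q * (b ^+ 2 * D)) <= q ^+ 2 * g2.
  have qg2 : `|q * g2| <= b ^+ 2 * D.
    by rewrite normrM gtr0_norm // (le_trans _ g2_le) // ler_wpM2r.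
  by have := ler_wpM2l (ltW q_gt0) (lerNnormlW qg2); lra.
(* The four bounds [T1] to [T4] share the factor [q], which cancels here. *)
suff K : m * b ^+ 2 <= N * (N - 1) * u ^+ 2 * m + 2 * N * b ^+ 2 * m
    - 2 * N * (u * (b * D)) - b ^+ 2 * D.
  have := ler_wpM2r (ltW q_gt0) K.
  by move=> ?; lra.
have K1 : N * (4 * D ^+ 2 * u ^+ 2) <= N * (N - 1) * u ^+ 2 * m ^+ 2.
  have -> : N * (N - 1) * u ^+ 2 * m ^+ 2 = N * ((N - 1) * m ^+ 2 * u ^+ 2) by ring.
  rewrite ler_wpM2l //; first lra.
  rewrite ler_wpM2r ?exprn_ge0 //.
  have : 0 <= m ^+ 2 by rewrite exprn_ge0 // ltW.
  lra.
(* After multiplication by [m], this square and [K1] absorb the cross term at the cost of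
   [N b^2 m^2 / 4]. With [K3], at least [3/4 N b^2 m^2] remains, and [N >= 2] makes this at least
   [3/2 b^2 m^2]. *)
have K2 : 0 <= N * (2 * D * u - b * m / 2) ^+ 2.
  by rewrite mulr_ge0 ?sqr_ge0 //; lra.
have K3 : b ^+ 2 * m * D <= b ^+ 2 * m * (N * m).
  by rewrite ler_wpM2l // mulr_ge0 ?exprn_ge0 // ltW.
have K4 : 2 * (m ^+ 2 * b ^+ 2) <= N * (m ^+ 2 * b ^+ 2).
  by rewrite ler_wpM2r // mulr_ge0 ?exprn_ge0 // ltW.
rewrite -(ler_pM2r m_gt0).
have K5 : 0 <= m ^+ 2 * b ^+ 2 by rewrite mulr_ge0 ?exprn_ge0 // ltW.
lra.
Qed.

(** The first entry of the maximum gives [D <= N m]; the third gives [N >= 2] and, multiplied by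
    [m^2], the last bound. *)
Lemma Nconst_bounds (R : realType) (m r D : R) (N : nat) :
  0 < m -> 0 < D -> Nconst m r D <= N%:R ->
  [/\ (2 <= N)%N, D <= N%:R * m & 4 * D ^+ 2 + m ^+ 2 <= (N%:R - 1) * m ^+ 2].
Proof.
move=> m_gt0 D_gt0; rewrite /Nconst !ge_max => /and4P[N1 _ N3 _].
have D2_ge0 : 0 <= 4 * D ^+ 2 / m ^+ 2 by rewrite divr_ge0 ?mulr_ge0 ?exprn_ge0 // ltW.
split.
- by rewrite -(ler_nat R); lra.
- rewrite -ler_pdivrMr //.
  have : 0 <= m / (16 * D) by rewrite divr_ge0 ?mulr_ge0 // ltW.
  lra.
- have m2_gt0 : 0 < m ^+ 2 by rewrite exprn_gt0.
  have : (4 * D ^+ 2 / m ^+ 2 + 2) * m ^+ 2 <= N%:R * m ^+ 2 by rewrite ler_pM2r.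
  rewrite mulrDl divfK ?gt_eqF //; lra.
Qed.

(** * Restriction to the line [x + t v] *)

Definition line_coord (R : nzRingType) (n : nat) (x v : 'rV[R]_n) (i : 'I_n) :
    {poly R} := (x 0 i)%:P + v 0 i *: 'X.

Definition line_poly (R : realType) (n : nat) (f : mpoly.mpoly n R)
    (x v : 'rV[R]_n) : {poly R} :=
  \sum_(nu <- mpoly.msupp f)
    (mpoly.mcoeff nu f)%:P * \prod_(i < n) line_coord x v i ^+ nu i.

Definition line_weight (R : nzRingType) (n : nat) (x v : 'rV[R]_n) : {poly R} :=
  1 + \sum_(i < n) line_coord x v i ^+ 2.

Lemma horner_line_coord (R : comNzRingType) (n : nat) (x v : 'rV[R]_n)
    (i : 'I_n) (t : R) : (line_coord x v i).[t] = (x + t *: v) 0 i.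
Proof. by rewrite !hornerE !mxE mulrC. Qed.

Lemma horner_line_poly (R : realType) (n : nat) (f : mpoly.mpoly n R)
    (x v : 'rV[R]_n) (t : R) : (line_poly f x v).[t] = peval f (x + t *: v).
Proof.
rewrite /peval mpoly.mevalE horner_sum; apply: eq_bigr => nu _.
rewrite hornerM hornerC horner_prod; congr (_ * _); apply: eq_bigr => i _.
by rewrite horner_exp horner_line_coord.
Qed.

Lemma horner_line_weight (R : realType) (n : nat) (x v : 'rV[R]_n) (t : R) :
  (line_weight x v).[t] = 1 + enorm (x + t *: v) ^+ 2.
Proof.
rewrite hornerD -polyC1 hornerC horner_sum sqr_sqrtr; last first.
  by apply: sumr_ge0 => i _; exact: sqr_ge0.
by congr (_ + _); apply: eq_bigr => i _; rewrite horner_exp horner_line_coord.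
Qed.

Lemma peval_phi_poly (R : realType) (n : nat) (f : mpoly.mpoly n R) (N : nat)
    (x : 'rV[R]_n) :
  peval (phi_poly f N) x = (1 + enorm x ^+ 2) ^+ N * peval f x.
Proof.
rewrite /peval /phi_poly mpoly.mevalM; congr (_ * _).
rewrite rmorphXn rmorphD rmorph1 rmorph_sum /= sqr_sqrtr; last first.
  by apply: sumr_ge0 => i _; exact: sqr_ge0.
congr ((_ + _) ^+ N); apply: eq_bigr => i _.
by rewrite rmorphXn /= mpoly.mevalXU.
Qed.

Lemma norm_coord_le (R : realType) (n : nat) (x : 'rV[R]_n) (i : 'I_n) :
  `|x 0 i| <= enorm x.
Proof.
rewrite -sqrtr_sqr ler_wsqrtr // (bigD1 i) //= lerDl.
by apply: sumr_ge0 => j _; exact: sqr_ge0.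
Qed.

Lemma line_weight_deriv2 (R : realType) (n : nat) (x v : 'rV[R]_n) :
  (line_weight x v)^`()^`() = (2 * enorm v ^+ 2)%:P.
Proof.
rewrite sqr_sqrtr; last by apply: sumr_ge0 => i _; exact: sqr_ge0.
rewrite /line_weight -polyC1 derivD derivC add0r !raddf_sum /= mulr_sumr raddf_sum.
apply: eq_bigr => i _; rewrite /line_coord expr2 !poly.derivE !scaler0 !add0r.
rewrite -!mul_polyC -[RHS]/((2 * v 0 i ^+ 2)%:P) expr2 !polyCM polyC_natr.
by ring.
Qed.

(** On the line, a monomial of degree [j] is a product of [j] affine functions with values at most
    [r] at [t] and slopes at most [|v|]. Its jet bounds, weighted by the coefficients of [f], sum to
    the expressions in [Dconst]. *)
Lemma line_poly_deriv_bounds (R : realType) (n : nat) (f : mpoly.mpoly n R)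
    (x v : 'rV[R]_n) (r t D : R) :
  Dconst f r <= D -> enorm (x + t *: v) <= r ->
  let g := line_poly f x v in
  Num.sqrt (1 + r ^+ 2) * `|(g^`()).[t]| <= enorm v * D /\
  (1 + r ^+ 2) * `|(g^`()^`()).[t]| <= enorm v ^+ 2 * D.
Proof.
rewrite /Dconst !ge_max => /and3P[_ D1 D2] z_le.
set b := enorm v; have b_ge0 : 0 <= b by exact: sqrtr_ge0.
have r_ge0 : 0 <= r by apply: le_trans z_le; exact: sqrtr_ge0.
have jet nu : jet_bound t r b (mpoly.mdeg nu)
    (\prod_(i < n) line_coord x v i ^+ nu i).
  rewrite mpoly.mdegE; apply: jet_bound_prod => // i.
  rewrite -[X in jet_bound _ _ _ X]mul1n; apply: jet_boundX => //.
  apply: jet_bound_line; last exact: norm_coord_le.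
  apply: le_trans z_le; apply: le_trans (norm_coord_le _ i).
  by rewrite !mxE mulrC.
have supp_lt : {in mpoly.msupp f, forall nu, mpoly.mdeg nu < mpoly.msize f}%N.
  by move=> nu; exact: mpoly.msize_mdeg_lt.
rewrite sum_by_degree // in D1; last by move=> nu [|j]; rewrite ?mul0r.
rewrite sum_by_degree // in D2; last by move=> nu [|[|j]]; rewrite ?mul0r.
split.
- apply: le_trans (ler_wpM2l b_ge0 D1); rewrite mulrCA.
  rewrite ler_wpM2l ?sqrtr_ge0 // raddf_sum /= horner_sum mulr_sumr.
  apply: (le_trans (ler_norm_sum _ _ _)); apply: ler_sum => nu _.
  rewrite derivM derivC mul0r add0r hornerM hornerC normrM.
  have [_ J _] := jet nu.
  by have := ler_wpM2l (normr_ge0 (mpoly.mcoeff nu f)) J; lra.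
- apply: le_trans (ler_wpM2l (exprn_ge0 2 b_ge0) D2); rewrite mulrCA.
  rewrite ler_wpM2l ?addr_ge0 ?sqr_ge0 // !raddf_sum /= horner_sum mulr_sumr.
  apply: (le_trans (ler_norm_sum _ _ _)); apply: ler_sum => nu _.
  rewrite !derivM derivC mul0r add0r derivM derivC mul0r add0r hornerM hornerC normrM.
  have [_ _ J] := jet nu.
  by have := ler_wpM2l (normr_ge0 (mpoly.mcoeff nu f)) J; lra.
Qed.

(** The exponent [k.+2] lets [q ^+ k] factor out without truncated subtraction. *)
Lemma deriv2_powM (R : comNzRingType) (q g : {poly R}) (k : nat) (t : R) :
  ((q ^+ k.+2 * g)^`()^`()).[t] =
  q.[t] ^+ k * (k.+2%:R * (k.+2%:R - 1) * (q^`()).[t] ^+ 2 * g.[t]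
    + k.+2%:R * (q^`()^`()).[t] * q.[t] * g.[t]
    + 2 * k.+2%:R * q.[t] * (q^`()).[t] * (g^`()).[t]
    + q.[t] ^+ 2 * (g^`()^`()).[t]).
Proof.
have dX j : (q ^+ j.+1)^`() = j.+1%:R%:P * (q^`() * q ^+ j).
  by rewrite deriv_exp polyC_natr mulr_natl.
rewrite derivM dX derivD [in X in X + _]derivM [(_%:P * _)^`()]derivM derivC mul0r.
rewrite add0r [(q^`() * _)^`()]derivM [(q ^+ _ * _)^`()]derivM !dX.
rewrite !(horner_exp, hornerD, hornerM, hornerC) -[k.+2%:R]natr1 !exprS.
by ring.
Qed.

(** * Strong convexity on [X] *)

Theorem theorem4p1 (R : realType) (n : nat) (f : mpoly.mpoly n R)
    (X : set 'rV[R]_n)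
    (X_compact : compact X)
    (X_convex : convex_set X)
    (X_two_points : exists x y, [/\ X x, X y & x <> y])
    (f_pos : forall x, X x -> 0 < peval f x)
    (r : R) (r_max : is_maximum [set enorm x | x in X] r)
    (fmin : R) (fmin_min : is_minimum [set peval f x | x in X] fmin)
    (m : R) (m_gt0 : 0 < m) (m_le : m <= fmin)
    (D : R) (D_ge : Dconst f r <= D)
    (N : nat) (N_ge : Nconst m r D <= N%:R) :
  strongly_convex X (peval (phi_poly f N)).
Proof.
have D_gt0 : 0 < D.
  by apply: (lt_le_trans ltr01); apply: le_trans D_ge; rewrite le_max lexx.
have [N_ge2 DN mDN] := Nconst_bounds m_gt0 D_gt0 N_ge.
exists m => // t x y; rewrite !inE => Xx Xy; rewrite convRE.
pose v : 'rV[R]_n := y - x.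
pose q := line_weight x v; pose g := line_poly f x v.
(* Since [q - 1] is the squared norm along the line, [p] is the function whose convexity is
   required. *)
pose p : {poly R} := q ^+ N * g - (m / 2) *: (q - 1).
have pE s : p.[s] = peval (phi_poly f N) (x + s *: v)
    - m / 2 * enorm (x + s *: v) ^+ 2.
  rewrite hornerD hornerN hornerZ hornerD hornerN -polyC1 hornerC.
  rewrite hornerM horner_exp horner_line_weight horner_line_poly peval_phi_poly.
  by congr (_ - _ * _); lra.
have conv_line (s : {i01 R}) :
    conv s (x : convex_lmodType 'rV[R]_n) y = x + (1 - s%:num) *: v.
  have -> : conv s (x : convex_lmodType 'rV[R]_n) y =
    s%:num *: x + (1 - s%:num) *: y by [].
  by rewrite /v scalerBr [(_ - _) *: x]scalerBl scale1r opprB addrCA subrKC addrC.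
have X_line (s : R) : 0 <= s <= 1 -> X (x + s *: v).
  move=> /andP[s_ge0 s_le1].
  have s'_ge0 : 0 <= 1 - s by rewrite subr_ge0.
  have s'_le1 : 1 - s <= 1 by rewrite gerBl.
  (* The weight in [conv] belongs to [x], so parameter [s] corresponds to weight [1 - s]. *)
  have := X_convex x y (Itv01 s'_ge0 s'_le1).
  by rewrite !inE conv_line /= subKr; exact.
have := @poly_convex01 R p t _.
rewrite !pE scale0r addr0 scale1r [x + v]addrC subrK -conv_line; apply => s s01.
set z := x + s *: v; have Xz : X z by exact: X_line.
have z_le : enorm z <= r by apply: r_max.2; exists z.
have [g1 g2] := line_poly_deriv_bounds D_ge z_le; rewrite -/g in g1 g2.
have m_le_g : m <= g.[s].
  by rewrite horner_line_poly (le_trans m_le) //; apply: fmin_min.2; exists z.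
have q_ge1 : 1 <= q.[s] by rewrite horner_line_weight lerDl sqr_ge0.
have q_le : q.[s] <= 1 + r ^+ 2.
  by rewrite horner_line_weight lerD2l ler_pXn2r ?nnegrE ?(le_trans _ z_le) ?sqrtr_ge0.
have r2_gt0 : 0 < 1 + r ^+ 2 by rewrite (lt_le_trans ltr01) // lerDl sqr_ge0.
case: N N_ge2 DN mDN @p pE {N_ge} => [|[|k]] // _ DN mDN p pE.
have q1_ge1 : 1 <= q.[s] ^+ k.+1 by rewrite exprn_ege1.
rewrite /p -polyC1 !(derivB, derivZ, derivC, deriv0, subr0) !(hornerD, hornerN, hornerZ).
rewrite deriv2_powM line_weight_deriv2 hornerC.
have q_bounds : 1 <= q.[s] <= 1 + r ^+ 2 by rewrite q_ge1.
have s_gt0 : 0 < Num.sqrt (1 + r ^+ 2) by rewrite sqrtr_gt0.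
have k2_ge2 : 2 <= k.+2%:R :> R by rewrite ler_nat.
have b_ge0 : 0 <= enorm v by exact: sqrtr_ge0.
have growth := power_growth_bound (q^`()).[s] m_gt0 (ltW D_gt0) b_ge0
  q_bounds s_gt0 (sqr_sqrtr (ltW r2_gt0)) m_le_g g1 g2 k2_ge2 DN mDN.
(* Multiplied by [q ^+ k], [growth] bounds the second derivative of phi_N below by
   [m |v|^2 q^(k+1)]. As [q >= 1], this is at least [m |v|^2], the second derivative of the
   subtracted term. *)
have := ler_wpM2l (exprn_ge0 k (le_trans ler01 q_ge1)) growth.
have := ler_wpM2l (mulr_ge0 (ltW m_gt0) (sqr_ge0 (enorm v))) q1_ge1.
rewrite [q.[s] ^+ k.+1]exprS -/g; lra.
Qed.
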